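(* Let $\delta>0$ and let $f(x)=\sum_{i=1}^{n}\alpha_i x^{p_i}\cos^{q_i}x\,\sin^{r_i}x$, where $n\in\mathbb{N}$, $\alpha_i\in\mathbb{R}\setminus\{0\}$ and $p_i,q_i,r_i\in\mathbb{N}_0$. For some choice of indices $l_k^{(i)}\in\mathbb{N}_0$ (for $1\le i\le n$ and $0\le k\le m_i$), let $P(x)=\sum_{i=1}^{n}\tau_i(x)$ be the associated polynomial (with $m_i$ and $\tau_i$ as defined in the context). Suppose that (i) the polynomial $P$ has at least one positive real root; and (ii) $P(x)>0$ for all $x\in(0,x^{*})$, where $x^{*}$ is the least positive real root of $P$, and that $(0,x^{*})\subseteq(0,\delta)$. Then $f(x)>0$ for all $x\in(0,x^{*})$.
   Context: $\mathbb{N}_0=\{0,1,2,\dots\}$; $\binom{a}{b}=0$ whenever $b>a$ or $b<0$; a sum over an empty index range is $0$. For odd $m$ let $T^{\sin,0}_m(t)=\sum_{j=0}^{(m-1)/2}\frac{(-1)^j t^{2j+1}}{(2j+1)!}$, and for even $m$ let $T^{\cos,0}_m(t)=\sum_{j=0}^{m/2}\frac{(-1)^j t^{2j}}{(2j)!}$ (the Maclaurin polynomials of sine and cosine). For each $i\in\{1,\dots,n\}$ put $m_i=\frac{q_i+r_i}{2}-1$ if $q_i,r_i$ have the same parity, and $m_i=\frac{q_i+r_i-1}{2}$ if they have different parity. The polynomial $\tau_i$ is defined as follows. Case 1: $r_i$ odd ($q_i$ odd or even). Put $\beta_k^{(i)}=\sum_{r=0}^{k}\alpha_i(-1)^{\frac{r_i-1}{2}+k+r}\binom{q_i}{r}\binom{r_i}{k-r}$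 and $$\tau_i(x)=\frac{x^{p_i}}{2^{q_i+r_i-1}}\sum_{k=0}^{m_i}\beta_k^{(i)}\,T^{\sin,0}_{4l_k^{(i)}+u}\big((q_i+r_i-2k)x\big),$$ where $u=3$ if $\beta_k^{(i)}>0$ and $u=1$ if $\beta_k^{(i)}<0$. Case 2: $q_i$ odd and $r_i$ even. Put $\gamma_k^{(i)}=\sum_{r=0}^{k}\alpha_i(-1)^{\frac{r_i}{2}+k+r}\binom{q_i}{r}\binom{r_i}{k-r}$ and $$\tau_i(x)=\frac{x^{p_i}}{2^{q_i+r_i-1}}\sum_{k=0}^{m_i}\gamma_k^{(i)}\,T^{\cos,0}_{4l_k^{(i)}+v}\big((q_i+r_i-2k)x\big),$$ where $v=2$ if $\gamma_k^{(i)}>0$ and $v=0$ if $\gamma_k^{(i)}<0$. Case 3: $q_i$ and $r_i$ both even. With $\gamma_k^{(i)}$ and $v$ given by the same formulas as in Case 2, $$\tau_i(x)=\frac{x^{p_i}}{2^{q_i+r_i-1}}\left(\sum_{k=0}^{m_i}\gamma_k^{(i)}\,T^{\cos,0}_{4l_k^{(i)}+v}\big((q_i+r_i-2k)x\big)+\frac{\alpha_i}{2}(-1)^{\frac{2r_i+q_i}{2}}\sum_{r=0}^{\frac{q_i+r_i}{2}}(-1)^r\binom{q_i}{r}\binom{r_i}{\frac{q_i+r_i}{2}-r}\right).$$ In all cases, terms with zero coefficient ($\beta_k^{(i)}=0$ or $\gamma_k^{(i)}=0$) contribute $0$. *)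

(* Defs.v *)
From mathcomp Require Import all_boot all_order all_algebra.
From mathcomp Require Import all_classical all_reals all_analysis.

Set Implicit Arguments.
Unset Strict Implicit.
Unset Printing Implicit Defensive.

Import Order.TTheory GRing.Theory Num.Theory.
Local Open Scope ring_scope.

Section MixedTrigPoly.
Variable R : realType.

(* Meant for odd m. *)
Definition sin_maclaurin (m : nat) : {poly R} :=
  \sum_(0 <= j < (m.-1)./2.+1)
     ((-1) ^+ j / ((2 * j + 1)`!)%:R) *: 'X^(2 * j + 1).

(* Meant for even m. *)
Definition cos_maclaurin (m : nat) : {poly R} :=
  \sum_(0 <= j < m./2.+1) ((-1) ^+ j / ((2 * j)`!)%:R) *: 'X^(2 * j).

(* The upper summation index, as an integer: it is -1 when q = r = 0. *)
Definition top_index (q r : nat) : int :=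
  if odd q == odd r then ((q + r)./2)%:Z - 1 else (((q + r).-1)./2)%:Z.

(* The number of k in {0, ..., top_index q r}; top_index q r + 1 >= 0, so the
   absolute value only converts it to nat. *)
Definition nb_terms (q r : nat) : nat := absz (top_index q r + 1).

Definition beta (a : R) (q r k : nat) : R :=
  \sum_(0 <= s < k.+1)
     a * (-1) ^+ ((r.-1)./2 + k + s) * 'C(q, s)%:R * 'C(r, k - s)%:R.

Definition gamma (a : R) (q r k : nat) : R :=
  \sum_(0 <= s < k.+1)
     a * (-1) ^+ (r./2 + k + s) * 'C(q, s)%:R * 'C(r, k - s)%:R.

(* The subtraction q + r - 2 * k never truncates in the range of summation.
   When beta or gamma vanishes the truncation degree is irrelevant, since the
   term is multiplied by 0. *)
Definition sin_sum (a : R) (q r : nat) (l : nat -> nat) : {poly R} :=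
  \sum_(0 <= k < nb_terms q r)
     beta a q r k *:
       (sin_maclaurin (4 * l k + (if 0 < beta a q r k then 3 else 1))
          \Po ((q + r - 2 * k)%:R *: 'X)).

Definition cos_sum (a : R) (q r : nat) (l : nat -> nat) : {poly R} :=
  \sum_(0 <= k < nb_terms q r)
     gamma a q r k *:
       (cos_maclaurin (4 * l k + (if 0 < gamma a q r k then 2 else 0))
          \Po ((q + r - 2 * k)%:R *: 'X)).

Definition middle_term (a : R) (q r : nat) : R :=
  a / 2 * (-1) ^+ ((2 * r + q)./2) *
  \sum_(0 <= s < ((q + r)./2).+1)
     (-1) ^+ s * 'C(q, s)%:R * 'C(r, (q + r)./2 - s)%:R.

(* The power of 2 has an integer exponent, equal to -1 when q = r = 0. *)
Definition tau (a : R) (p q r : nat) (l : nat -> nat) : {poly R} :=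
  ((2 : R) ^ ((q + r)%:Z - 1))^-1 *:
  ('X^p * (if odd r then sin_sum a q r l
           else if odd q then cos_sum a q r l
           else cos_sum a q r l + (middle_term a q r)%:P)).

Definition mtp (n : nat) (alpha : 'I_n -> R) (p q r : 'I_n -> nat) (x : R) : R :=
  \sum_(i < n) alpha i * x ^+ p i * cos x ^+ q i * sin x ^+ r i.

(* Only the values l i k with k <= top_index (q i) (r i) matter. *)
Definition assoc_poly (n : nat) (alpha : 'I_n -> R) (p q r : 'I_n -> nat)
    (l : 'I_n -> nat -> nat) : {poly R} :=
  \sum_(i < n) tau (alpha i) (p i) (q i) (r i) (l i).

Definition least_pos_root (P : {poly R}) (x : R) : Prop :=
  [/\ 0 < x, root P x & forall y : R, 0 < y -> root P y -> x <= y].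

End MixedTrigPoly.

(* Main.v *)
Require Import Defs.
From mathcomp Require Import all_boot all_order all_algebra.
From mathcomp Require Import all_classical all_reals all_analysis.
From mathcomp Require Import ring lra zify.

Import Order.TTheory GRing.Theory Num.Theory.
Local Open Scope classical_set_scope.
Local Open Scope ring_scope.

(** The polynomial [P] is a lower bound of [f] on the whole half-line [x >= 0],
    so [f] is positive wherever [P] is. The bound is obtained summand by summand
    ([tau_le]), from two ingredients.

    - An exact product-to-sum formula. Write [n = q + r] and let [B_k] be the
      coefficient of [X^k] in [(1 + X)^q (1 - X)^r]. Then [2^n cos^q x sin^r x]
      is, up to the sign [(-1)^(r/2)] (with [r/2] rounded down), the sum of
      [B_k g ((n - 2k) x)] over [0 <= k <= n], where [g] is [sin] if [r] is odd
      and [cos] if [r] is even. This is what the expansion of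
      [(w + w^-1)^q (w - w^-1)^r] at [w = e^(ix)] gives; here it is proved over
      the reals, by multiplying the polynomial by one linear factor at a time
      ([cos_transform_mul_1DX]). The terms [k] and [n - k] are equal because
      [B_(n-k) = (-1)^r B_k] and [g] has the parity of [r], so the sum folds into
      twice its first half plus, for [q] and [r] both even, a middle term
      ([product_to_sum]). The numbers [gamma] (and [beta], for odd [r]) are these
      coefficients with the sign and the factor [a] put in.

    - The alternation of the Maclaurin polynomials of [sin] and [cos] around
      their limits on [t >= 0] ([maclaurin_alternate]): a polynomial whose last
      term is negative lies below the function, one whose last term is positive
      lies above. The truncation degrees in [tau] are chosen by the sign of the
      coefficient: a lower bound for a positive coefficient and an upper bound for
      a negative one. Hence every truncated term is at most the exact one. *)

(** * Alternating Maclaurin bounds for sine and cosine *)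

Lemma ge0_of_derive_ge0 (R : realType) (g dg : R -> R) :
  g 0 = 0 -> (forall t, is_derive t (1 : R) g (dg t)) ->
  (forall t, 0 <= t -> 0 <= dg t) -> forall t, 0 <= t -> 0 <= g t.
Proof.
move=> g0 g_dg dg_ge0 t t_ge0; rewrite -g0.
have g_drv u : derivable g u 1 by have [] := g_dg u.
apply: (@ger0_derive1_ndecr R g 0 t) => // [u|].
  rewrite in_itv /= => /andP[u_gt0 _].
  by rewrite derive1E (@derive_val _ _ _ _ _ _ _ (g_dg u)) dg_ge0 // ltW.
by apply: derivable_within_continuous => u _.
Qed.

Lemma deriv_sin_maclaurin (R : realType) (j : nat) :
  (sin_maclaurin R (2 * j + 1))^`() = cos_maclaurin R (2 * j).
Proof.
rewrite /sin_maclaurin /cos_maclaurin addn1 /= mul2n doubleK raddf_sum /=.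
apply: eq_bigr => i _; rewrite derivZ derivXn addn1 /= -scalerMnr scalerMnl.
congr (_ *: _); rewrite -mulr_natr factS natrM invfM -!mulrA; congr (_ * _).
by rewrite mulrC mulfK ?pnatr_eq0.
Qed.

Lemma deriv_cos_maclaurin (R : realType) (j : nat) :
  (cos_maclaurin R (2 * j.+1))^`() = - sin_maclaurin R (2 * j + 1).
Proof.
rewrite /sin_maclaurin /cos_maclaurin addn1 mul2n doubleK.
rewrite mul2n doubleK raddf_sum /=.
rewrite big_nat_recl // muln0 derivZ derivXn mulr0n scaler0 add0r -sumrN.
apply: eq_bigr => i _; rewrite mulnS derivZ derivXn /= -scalerMnr scalerMnl.
rewrite -scaleNr -mulr_natr addn1 add2n (factS (2 * i).+1) natrM invfM exprS mulN1r !mulNr.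
congr (- _ *: _); rewrite -!mulrA; congr (_ * _).
by rewrite mulrC mulfK ?pnatr_eq0.
Qed.

Lemma horner0_sin_maclaurin (R : realType) (m : nat) : (sin_maclaurin R m).[0] = 0.
Proof.
rewrite horner_sum big1 // => i _.
by rewrite hornerZ hornerXn addn1 expr0n mulr0.
Qed.

Lemma horner0_cos_maclaurin (R : realType) (m : nat) : (cos_maclaurin R m).[0] = 1.
Proof.
rewrite horner_sum big_nat_recl // muln0 fact0 expr0 divr1 scale1r hornerXn expr0.
by rewrite big1 ?addr0 // => i _; rewrite hornerZ hornerXn mulnS expr0n mulr0.
Qed.

Lemma cos_maclaurin0 (R : realType) : cos_maclaurin R 0 = 1.
Proof.
by rewrite /cos_maclaurin big_nat1 muln0 fact0 expr0 divr1 scale1r.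
Qed.

(** Each bound is the integral of the previous one: the error of the sine
    polynomial of degree [2j + 1] vanishes at 0 and has the error of the cosine
    polynomial of degree [2j] as derivative, and differentiating the next cosine
    error gives the opposite of that sine error, whence the change of sign. The
    induction starts from [cos t <= 1]. *)
Lemma maclaurin_alternate (R : realType) (j : nat) :
  (forall t : R, 0 <= t -> 0 <= (-1) ^+ j * ((cos_maclaurin R (2 * j)).[t] - cos t)) /\
  (forall t : R, 0 <= t -> 0 <= (-1) ^+ j * ((sin_maclaurin R (2 * j + 1)).[t] - sin t)).
Proof.
have sin_of_cos i :
  (forall t : R, 0 <= t -> 0 <= (-1) ^+ i * ((cos_maclaurin R (2 * i)).[t] - cos t)) ->
  forall t : R, 0 <= t -> 0 <= (-1) ^+ i * ((sin_maclaurin R (2 * i + 1)).[t] - sin t).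
  apply: ge0_of_derive_ge0 => [|t].
    by rewrite horner0_sin_maclaurin sin0 subrr mulr0.
  rewrite -deriv_sin_maclaurin.
  have Hp := is_derive_poly (sin_maclaurin R (2 * i + 1)) t.
  have Hs := is_derive_sin t.
  exact: (is_deriveZ ((-1) ^+ i) (is_deriveB Hp Hs)).
have cos_of_sin i :
  (forall t : R, 0 <= t -> 0 <= (-1) ^+ i * ((sin_maclaurin R (2 * i + 1)).[t] - sin t)) ->
  forall t : R, 0 <= t -> 0 <= (-1) ^+ i.+1 * ((cos_maclaurin R (2 * i.+1)).[t] - cos t).
  apply: ge0_of_derive_ge0 => [|t].
    by rewrite horner0_cos_maclaurin cos0 subrr mulr0.
  have Hp := is_derive_poly (cos_maclaurin R (2 * i.+1)) t.
  apply: is_derive_eq (is_deriveZ _ (is_deriveB Hp (is_derive_cos t))) _.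
  rewrite deriv_cos_maclaurin hornerN -opprD scalerN exprS mulN1r.
  by rewrite scaleNr opprK.
have cos_j : forall t : R, 0 <= t ->
    0 <= (-1) ^+ j * ((cos_maclaurin R (2 * j)).[t] - cos t).
  elim: j => [t _|j IHj]; last exact/cos_of_sin/sin_of_cos.
  by rewrite mul1r cos_maclaurin0 hornerC subr_ge0 cos_le1.
by split; last exact: sin_of_cos.
Qed.

(** * The coefficients of (1 + X)^q (1 - X)^r *)

Definition binomial_prod (R : realType) (q r : nat) : {poly R} :=
  (1 + 'X) ^+ q * (1 - 'X) ^+ r.

Lemma coef_exp1DX (R : realType) (e : R) (q s : nat) :
  ((1 + e *: 'X) ^+ q)`_s = e ^+ s * 'C(q, s)%:R.
Proof.
elim: q s => [|q IHq] s.
  by rewrite expr0 coef1 bin0n; case: s => [|s]; rewrite ?mulr1 ?mulr0.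
rewrite exprS mulrDl mul1r -scalerAl coefD coefZ coefXM !IHq.
case: s => [|s] /=; first by rewrite mulr0 addr0 !bin0.
by rewrite binS natrD mulrDr exprS mulrA.
Qed.

Lemma coef_binomial_prod (R : realType) (q r k : nat) :
  (binomial_prod R q r)`_k =
  \sum_(0 <= s < k.+1) (-1) ^+ (k + s) * 'C(q, s)%:R * 'C(r, k - s)%:R.
Proof.
have -> : binomial_prod R q r = (1 + 1 *: 'X) ^+ q * (1 + (-1) *: 'X) ^+ r.
  by rewrite scale1r scaleN1r.
rewrite coefM big_mkord; apply: eq_bigr => -[s /=]; rewrite ltnS => s_le_k _.
rewrite !coef_exp1DX expr1n mul1r mulrA [in LHS](mulrC 'C(q, s)%:R).
congr (_ * _ * _).
by rewrite -[in RHS](subnK s_le_k) -addnA addnn -mul2n exprD exprM sqrrN !expr1n mulr1.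
Qed.

Lemma binomial_prodSl (R : realType) (q r : nat) :
  binomial_prod R q.+1 r = (1 + 1 *: 'X) * binomial_prod R q r.
Proof. by rewrite /binomial_prod scale1r exprS mulrA. Qed.

Lemma binomial_prodSr (R : realType) (q r : nat) :
  binomial_prod R q r.+1 = (1 + (-1) *: 'X) * binomial_prod R q r.
Proof. by rewrite /binomial_prod scaleN1r exprS mulrCA. Qed.

Lemma size_mul_1DX (R : realType) (e : R) (P : {poly R}) (n : nat) :
  (size P <= n)%N -> (size ((1 + e *: 'X) * P)%R <= n.+1)%N.
Proof.
move=> sP; apply: leq_trans (size_polyMleq _ _) _.
suff : (size (1 + e *: 'X)%R <= 2)%N by move: sP; lia.
apply: leq_trans (size_polyD _ _) _; rewrite geq_max size_poly1 /=.
by apply: leq_trans (size_scale_leq _ _) _; rewrite size_polyX.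
Qed.

Lemma size_binomial_prod (R : realType) (q r : nat) :
  (size (binomial_prod R q r) <= (q + r).+1)%N.
Proof.
elim: r => [|r IHr]; last by rewrite binomial_prodSr addnS size_mul_1DX.
elim: q => [|q IHq]; last by rewrite binomial_prodSl addSn size_mul_1DX.
by rewrite /binomial_prod !expr0 mulr1 size_poly1.
Qed.

(** Multiplying by [1 + e X] with [e = 1] or [e = -1] preserves being palindromic
    up to a sign, and multiplies that sign by [e]. *)
Lemma coef_mul_1DX_rev (R : realType) (e sgn : R) (P : {poly R}) (n : nat) :
  e * e = 1 -> (size P <= n.+1)%N ->
  (forall k, (k <= n)%N -> P`_(n - k) = sgn * P`_k) ->
  forall k, (k <= n.+1)%N ->
    ((1 + e *: 'X) * P)`_(n.+1 - k) = e * sgn * ((1 + e *: 'X) * P)`_k.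
Proof.
move=> ee sP revP k k_le.
have coefQ i : ((1 + e *: 'X) * P)`_i = P`_i + e * (if i == 0 then 0 else P`_i.-1).
  by rewrite mulrDl mul1r -scalerAl coefD coefZ coefXM.
have Pn1 : P`_n.+1 = 0 by rewrite nth_default.
have P0 := revP 0 isT; rewrite subn0 in P0.
have Pn := revP n (leqnn n); rewrite subnn in Pn.
rewrite !coefQ; case: k k_le => [|k] k_le; rewrite ?subn0 ?subSS /=.
  by rewrite Pn1 P0; ring.
have [->|k_neq] := eqVneq k n.
  by rewrite subnn eqxx Pn1 Pn; ring: ee.
have k_lt : (k < n)%N by rewrite ltn_neqAle k_neq.
have -> : (n - k == 0)%N = false by apply/negbTE; rewrite subn_eq0 -ltnNge.
rewrite revP ?(ltnW k_lt) // -subnS revP //; ring: ee.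
Qed.

Lemma coef_binomial_prod_rev (R : realType) (q r k : nat) :
  (k <= q + r)%N ->
  (binomial_prod R q r)`_(q + r - k) = (-1) ^+ r * (binomial_prod R q r)`_k.
Proof.
elim: r k => [|r IHr] k; last first.
  rewrite binomial_prodSr addnS exprS => k_le.
  by apply: coef_mul_1DX_rev; rewrite ?size_binomial_prod ?mulrNN ?mulr1.
elim: q k => [|q IHq] k; last first.
  rewrite binomial_prodSl addSn => k_le; rewrite -[(-1) ^+ 0]mul1r.
  by apply: coef_mul_1DX_rev; rewrite ?size_binomial_prod ?mulr1.
by rewrite addn0 leqn0 => /eqP ->; rewrite mul1r.
Qed.

(** * The product-to-sum formula *)

(** For [P = \sum_k P_k X^k] this is the real part of
    [e^(iy) w^n P(w^-2)] at [w = e^(ix)]. The free phase [y] is what makes an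
    induction on the factors of [P] possible without complex numbers. *)
Definition cos_transform {R : realType} (n : nat) (P : {poly R}) (x y : R) : R :=
  \sum_(0 <= k < n.+1) P`_k * cos ((n%:R - 2 * k%:R) * x + y).

(** In the complex picture, [w^(n+1) (1 + e w^-2) = w^n (w + e w^-1)]: a linear
    factor turns into the two phase shifts by [x] and [-x]. *)
Lemma cos_transform_mul_1DX (R : realType) (e : R) (n : nat) (P : {poly R}) (x y : R) :
  (size P <= n.+1)%N ->
  cos_transform n.+1 ((1 + e *: 'X) * P) x y =
  cos_transform n P x (y + x) + e * cos_transform n P x (y - x).
Proof.
move=> sP; rewrite /cos_transform.
under eq_bigr => k _ do
  rewrite mulrDl mul1r -scalerAl coefD coefZ coefXM mulrDl -mulrA.
rewrite big_split /= -mulr_sumr; congr (_ + _ * _).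
  rewrite [LHS]big_nat_recr //= nth_default // mul0r addr0.
  by apply: eq_bigr => k _; congr (_ * cos _); rewrite -natr1; ring.
rewrite [LHS]big_nat_recl //= mul0r add0r.
by apply: eq_bigr => k _; congr (_ * cos _); rewrite -!natr1; ring.
Qed.

(** By the sum formulas for [cos], a factor [1 + X] contributes [2 cos x], and a
    factor [1 - X] contributes [2 sin x] together with a phase shift of a quarter
    turn (the factor [i] of [w - w^-1 = 2 i sin x]). *)
Lemma cos_transform_binomial_prod (R : realType) (q r : nat) (x y : R) :
  cos_transform (q + r) (binomial_prod R q r) x y =
  2 ^+ (q + r) * cos x ^+ q * sin x ^+ r * cos (y + r%:R * (pi / 2)).
Proof.
elim: r y => [|r IHr] y; last first.
  rewrite binomial_prodSr addnS cos_transform_mul_1DX ?size_binomial_prod //.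
  rewrite !IHr.
  have -> : y + r.+1%:R * (pi / 2) = (y + r%:R * (pi / 2)) + pi / 2.
    by rewrite -natr1; ring.
  rewrite (addrAC y x) (addrAC y (- x)); set z := y + _.
  rewrite cosDpihalf (cosD z) (cosB z) !exprS; ring.
elim: q y => [|q IHq] y; last first.
  rewrite binomial_prodSl addSn cos_transform_mul_1DX ?size_binomial_prod //.
  rewrite !IHq (addrAC y x) (addrAC y (- x)); set z := y + _.
  rewrite (cosD z) (cosB z) !exprS; ring.
rewrite addn0 /cos_transform big_nat1 /binomial_prod !expr0 !mul1r coef1 eqxx.
by rewrite !(mul1r, mulr1, mul0r, mulr0, oppr0, add0r, addr0).
Qed.

Lemma sum_fold (R : realType) (n : nat) (F : nat -> R) :
  (forall k, (k <= n)%N -> F (n - k)%N = F k) ->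
  \sum_(0 <= k < n.+1) F k =
  2 * (\sum_(0 <= k < uphalf n) F k) + (if odd n then 0 else F n./2).
Proof.
move=> revF; rewrite (@big_cat_nat _ _ _ (uphalf n)) /=; [|by lia..].
have -> : \sum_(uphalf n <= k < n.+1) F k = \sum_(0 <= k < n./2.+1) F k.
  rewrite big_nat_rev /= -{1}[uphalf n]add0n big_addn.
  have -> : (n.+1 - uphalf n = n./2.+1)%N by lia.
  apply: eq_big_nat => k /andP[_ k_lt].
  rewrite -[RHS]revF; last by lia.
  by congr F; lia.
case: ifP => n_odd.
  have -> : n./2.+1 = uphalf n by lia.
  by ring.
have -> : uphalf n = n./2 by lia.
by rewrite big_nat_recr //=; ring.
Qed.

Definition trig_of_parity {R : realType} (b : bool) : R -> R :=
  if b then @sin R else @cos R.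

Lemma cos_nat_mul_pi (R : realType) (h : nat) : cos (h%:R * pi) = (-1) ^+ h :> R.
Proof.
elim: h => [|h IHh]; first by rewrite mul0r cos0.
by rewrite -natr1 mulrDl mul1r cosDpi IHh exprS mulN1r.
Qed.

Lemma trig_of_parityN (R : realType) (r : nat) (z : R) :
  trig_of_parity (odd r) (- z) = (-1) ^+ r * trig_of_parity (odd r) z.
Proof.
rewrite -signr_odd /trig_of_parity.
by case: (odd r); rewrite ?sinN ?cosN ?mulN1r ?mul1r.
Qed.

(** The phase [y] below is 0 for even [r] and minus a quarter turn for odd [r],
    which turns [cos] into [sin] and makes the accumulated phase
    [y + r (pi / 2)] a multiple of [pi]. The sum then folds; when [q] and [r] are
    both odd, the middle term vanishes because it is a multiple of [sin 0]. *)
Lemma product_to_sum (R : realType) (q r : nat) (x : R) :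
  2 ^+ (q + r) * cos x ^+ q * sin x ^+ r =
  (-1) ^+ r./2 *
  (2 * (\sum_(0 <= k < uphalf (q + r))
          (binomial_prod R q r)`_k *
          trig_of_parity (odd r) ((q + r - 2 * k)%:R * x)) +
   (if odd q || odd r then 0 else (binomial_prod R q r)`_((q + r)./2))).
Proof.
set y := - ((odd r)%:R * (pi / 2)) : R.
have shiftE z : cos (z + y) = trig_of_parity (odd r) z.
  rewrite /y /trig_of_parity.
  by case: (odd r); rewrite ?mul1r ?cosBpihalf ?mul0r ?subr0.
have := cos_transform_binomial_prod R q r x y.
have -> : y + r%:R * (pi / 2) = r./2%:R * pi.
  by rewrite -[in r%:R](odd_double_half r) -muln2 natrD natrM /y; field.
rewrite cos_nat_mul_pi => eqL.
rewrite -[LHS](signrMK r./2) [(-1) ^+ _ * (2 ^+ _ * _ * _)]mulrC -eqL.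
congr (_ * _); rewrite /cos_transform sum_fold => [|k k_le].
  congr (2 * _ + _).
    apply: eq_big_nat => k /andP[_ k_lt].
    by rewrite shiftE natrB ?natrM //; lia.
  rewrite shiftE oddD.
  have middle_angle : odd q = odd r -> (q + r)%:R - 2 * ((q + r)./2)%:R = 0 :> R.
    move=> same_parity; rewrite -natrM -natrB; last by lia.
    by have -> : (q + r - 2 * (q + r)./2 = 0)%N by lia.
  case q_odd: (odd q) middle_angle; case r_odd: (odd r) => //= ->; rewrite ?mul0r //.
    by rewrite sin0 mulr0.
  by rewrite cos0 mulr1.
rewrite !shiftE coef_binomial_prod_rev // natrB //.
have -> : ((q + r)%:R - 2 * ((q + r)%:R - k%:R)) * x =
    - (((q + r)%:R - 2 * k%:R) * x) by ring.
by rewrite trig_of_parityN mulrACA -expr2 sqrr_sign mul1r.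
Qed.

(** * Comparison of each summand with its polynomial *)

Lemma nb_terms_uphalf (q r : nat) : nb_terms q r = uphalf (q + r).
Proof. by rewrite /nb_terms /top_index; case: eqP => H; lia. Qed.

Lemma gamma_binomial_prod (R : realType) (a : R) (q r k : nat) :
  gamma a q r k = a * (-1) ^+ r./2 * (binomial_prod R q r)`_k.
Proof.
rewrite /gamma coef_binomial_prod mulr_sumr; apply: eq_bigr => s _.
by rewrite -addnA exprD !mulrA.
Qed.

Lemma beta_gamma (R : realType) (a : R) (q r k : nat) :
  odd r -> beta a q r k = gamma a q r k.
Proof.
move=> r_odd; apply: eq_bigr => s _.
by have -> : (r.-1)./2 = r./2 by lia.
Qed.

Lemma middle_term_binomial_prod (R : realType) (a : R) (q r : nat) :
  ~~ odd q -> ~~ odd r ->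
  middle_term a q r =
  a / 2 * (-1) ^+ r./2 * (binomial_prod R q r)`_((q + r)./2).
Proof.
move=> q_even r_even; rewrite /middle_term coef_binomial_prod -!mulrA.
congr (_ * (_ * _)); rewrite !mulr_sumr; apply: eq_bigr => s _.
rewrite !mulrA -!exprD addnA; congr (_ ^+ _ * _ * _).
lia.
Qed.

(** The degree [4 l + 3] polynomial ends with a negative term, the one of degree
    [4 l + 1] with a positive term; multiplying by [c] reverses the order for
    [c <= 0]. When [c = 0] both sides vanish. *)
Lemma scaled_sin_maclaurin_le (R : realType) (c t : R) (l : nat) :
  0 <= t ->
  c * (sin_maclaurin R (4 * l + (if 0 < c then 3 else 1))).[t] <= c * sin t.
Proof.
move=> t_ge0; case: ifP => [c_gt0|/negbT]; last rewrite -leNgt => c_le0.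
  have [_ /(_ _ t_ge0)] := maclaurin_alternate R (2 * l).+1.
  have -> : (4 * l + 3 = 2 * (2 * l).+1 + 1)%N by lia.
  rewrite exprS exprM sqrrN !expr1n mulr1 mulN1r oppr_ge0 subr_le0.
  by rewrite ler_pM2l.
have [_ /(_ _ t_ge0)] := maclaurin_alternate R (2 * l).
rewrite mulnA exprM sqrrN !expr1n mul1r subr_ge0.
exact: ler_wnM2l.
Qed.

Lemma scaled_cos_maclaurin_le (R : realType) (c t : R) (l : nat) :
  0 <= t ->
  c * (cos_maclaurin R (4 * l + (if 0 < c then 2 else 0))).[t] <= c * cos t.
Proof.
move=> t_ge0; case: ifP => [c_gt0|/negbT]; last rewrite -leNgt => c_le0.
  have [/(_ _ t_ge0) + _] := maclaurin_alternate R (2 * l).+1.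
  have -> : (4 * l + 2 = 2 * (2 * l).+1)%N by lia.
  rewrite exprS exprM sqrrN !expr1n mulr1 mulN1r oppr_ge0 subr_le0.
  by rewrite ler_pM2l.
have [/(_ _ t_ge0) + _] := maclaurin_alternate R (2 * l).
rewrite mulnA addn0 exprM sqrrN !expr1n mul1r subr_ge0.
exact: ler_wnM2l.
Qed.

Lemma sin_sum_le (R : realType) (a : R) (q r : nat) (l : nat -> nat) (x : R) :
  0 <= x ->
  (sin_sum a q r l).[x] <=
  \sum_(0 <= k < uphalf (q + r)) beta a q r k * sin ((q + r - 2 * k)%:R * x).
Proof.
move=> x_ge0; rewrite /sin_sum nb_terms_uphalf horner_sum; apply: ler_sum => k _.
rewrite hornerZ horner_comp hornerZ hornerX.
by rewrite scaled_sin_maclaurin_le // mulr_ge0.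
Qed.

Lemma cos_sum_le (R : realType) (a : R) (q r : nat) (l : nat -> nat) (x : R) :
  0 <= x ->
  (cos_sum a q r l).[x] <=
  \sum_(0 <= k < uphalf (q + r)) gamma a q r k * cos ((q + r - 2 * k)%:R * x).
Proof.
move=> x_ge0; rewrite /cos_sum nb_terms_uphalf horner_sum; apply: ler_sum => k _.
rewrite hornerZ horner_comp hornerZ hornerX.
by rewrite scaled_cos_maclaurin_le // mulr_ge0.
Qed.

(** The prefactor is [2 / 2^n], whose 2 is the one produced by folding; the middle
    term is not doubled, which explains the [a / 2] in [middle_term]. *)
Lemma product_to_sum_gamma (R : realType) (a : R) (q r : nat) (x : R) :
  a * cos x ^+ q * sin x ^+ r =
  ((2 : R) ^ ((q + r)%:Z - 1))^-1 *
  (\sum_(0 <= k < uphalf (q + r))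
      gamma a q r k * trig_of_parity (odd r) ((q + r - 2 * k)%:R * x) +
   (if odd q || odd r then 0 else middle_term a q r)).
Proof.
have pow2E : ((2 : R) ^ ((q + r)%:Z - 1))^-1 = 2 / 2 ^+ (q + r).
  by rewrite expfzDr ?pnatr_eq0 // invfM mulrC exprN1 invrK.
have pow2_neq0 : 2 ^+ (q + r) != 0 :> R by rewrite expf_neq0 ?pnatr_eq0.
apply: (mulfI pow2_neq0).
under eq_bigr => k _ do rewrite gamma_binomial_prod -mulrA.
rewrite -mulr_sumr pow2E -[a * _ * _]mulrA mulrCA (mulrA _ (cos x ^+ q)).
rewrite product_to_sum.
set S := \sum_(_ <= _ < _) _.
case: ifP => [_|/norP[q_even r_even]].
  by field.
by rewrite middle_term_binomial_prod //; field.
Qed.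

Lemma tau_le (R : realType) (a : R) (p q r : nat) (l : nat -> nat) (x : R) :
  0 <= x -> (tau a p q r l).[x] <= a * x ^+ p * cos x ^+ q * sin x ^+ r.
Proof.
move=> x_ge0.
have -> : a * x ^+ p * cos x ^+ q * sin x ^+ r =
    x ^+ p * (a * cos x ^+ q * sin x ^+ r) by ring.
rewrite product_to_sum_gamma mulrCA /tau hornerZ hornerM hornerXn.
apply: ler_wpM2l; first by rewrite invr_ge0 exprz_ge0.
apply: ler_wpM2l; first by rewrite exprn_ge0.
case: ifP => r_odd.
  rewrite orbT addr0; apply: le_trans (sin_sum_le _ _ _ _ _ _ x_ge0) _.
  by under eq_bigr => k _ do rewrite beta_gamma //.
case: ifP => q_odd /=; first by rewrite addr0 cos_sum_le.
by rewrite hornerD hornerC lerD2r cos_sum_le.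
Qed.

Theorem theorem2p1 (R : realType) (delta : R) (n : nat) (alpha : 'I_n -> R)
    (p q r : 'I_n -> nat) (l : 'I_n -> nat -> nat) (xstar : R)
    (delta_gt0 : 0 < delta)
    (n_gt0 : (0 < n)%N)
    (alpha_neq0 : forall i, alpha i != 0)
    (P_has_root : exists x : R, 0 < x /\ root (assoc_poly alpha p q r l) x)
    (xstar_least : least_pos_root (assoc_poly alpha p q r l) xstar)
    (P_gt0 : forall x : R, x \in `]0, xstar[ -> 0 < (assoc_poly alpha p q r l).[x])
    (sub_delta : `]0, xstar[%classic `<=` `]0, delta[%classic) :
  forall x : R, x \in `]0, xstar[ -> 0 < mtp alpha p q r x.
Proof.
move=> x x_in; apply: lt_le_trans (P_gt0 x x_in) _.
have x_gt0 : 0 < x by move: x_in; rewrite in_itv /= => /andP[].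
by rewrite /assoc_poly horner_sum; apply: ler_sum => i _; rewrite tau_le ?ltW.
Qed.
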